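(* Fix $\rho\in(0,1)$ and let $G\in\mathcal{G}(n,\rho)$ be an Erdős–Rényi random graph. Then with probability tending to $1$ as $n\to\infty$, $G$ is connected and its all-terminal reliability polynomial $\mathrm{Rel}(G;q)$ has a nonreal root.
   Context: $\mathcal{G}(n,\rho)$ is the random simple graph on $n$ labelled vertices in which each of the $\binom{n}{2}$ possible edges is present independently with probability $\rho$; ''almost every graph has property $P$'' means the probability that $G\in\mathcal{G}(n,\rho)$ has $P$ tends to $1$ as $n\to\infty$. For a connected graph $G=(V,E)$ in which each edge fails independently with probability $q$, the all-terminal reliability is $\mathrm{Rel}(G;q)=\sum_{E'}(1-q)^{|E'|}q^{|E|-|E'|}$, where the sum ranges over all $E'\subseteq E$ such that the spanning subgraph $(V,E')$ is connected; this is a polynomial in $q$. *)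

(* Defs.v *)
From HB Require Import structures.
From mathcomp Require Import all_boot all_order all_algebra.
From mathcomp Require Import complex.
From mathcomp Require Import all_classical all_reals all_analysis.

Set Implicit Arguments.
Unset Strict Implicit.
Unset Printing Implicit Defensive.

Import Order.TTheory GRing.Theory Num.Theory.
Import numFieldNormedType.Exports.
Local Open Scope ring_scope.

(* A simple graph with vertex type V is represented by its edge set, a subset
   of [vpairs V]; an edge is a two-element set of vertices. *)
Definition vpairs (V : finType) : {set {set V}} := [set e : {set V} | #|e| == 2%N].

Definition edge_rel (V : finType) (E : {set {set V}}) : rel V :=
  [rel x y | (x != y) && ([set x; y]%SET \in E)].

Definition graph_connected (V : finType) (E : {set {set V}}) : bool :=
  (0 < #|V|)%N && [forall x, forall y, connect (edge_rel E) x y].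

(* The variable 'X is the edge failure probability q. *)
Definition rel_poly (R : nzRingType) (V : finType) (E : {set {set V}}) : {poly R} :=
  \sum_(F in powerset E | graph_connected F)
    (1 - 'X) ^+ #|F| * 'X ^+ (#|E| - #|F|).

Definition has_nonreal_root (R : rcfType) (p : {poly R}) : Prop :=
  exists2 z : R[i], root (map_poly (real_complex R) p) z & complex.Im z != 0.

(* The law of the random graph: each vertex pair is an edge with probability
   rho, independently of the others, so the mass of E is a product over all
   vertex pairs. *)
Definition gnp_mass (R : realType) (n : nat) (rho : R) (E : {set {set 'I_n}}) : R :=
  \prod_(e in vpairs 'I_n) (if e \in E then rho else 1 - rho).

Definition gnp_prob (R : realType) (n : nat) (rho : R)
    (A : {set {set 'I_n}} -> Prop) : R :=
  \sum_(E in powerset (vpairs 'I_n) | `[< A E >]) gnp_mass rho E.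

(* Main.v *)
Require Import Defs.
From HB Require Import structures.
From mathcomp Require Import all_boot all_order all_algebra.
From mathcomp Require Import complex.
From mathcomp Require Import ring lra zify.
From mathcomp Require Import all_classical all_reals all_analysis.

(** If no set of at most two edges disconnects [G], then the disconnected
    terms missing from the expansion of [((1 - q) + q) ^ |E| = 1] are all
    divisible by [q^3], so [Rel(G; q) = 1 + O(q^3)].  Were all its roots real,
    it would factor as the product of the [1 - a_i q] with [a_i] real, and
    vanishing coefficients of [q] and [q^2] would give [sum a_i^2 = 0], hence
    [Rel = 1], contradicting [Rel(G; 1) = 0].
    The edge-connectivity condition holds as soon as any two distinct vertices
    have three common neighbours; by a union bound over [(x, y, u, v)] this
    fails with probability at most [n^4 (1 - rho^2)^(n - 4)], which tends
    to 0. *)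

Set Implicit Arguments.
Unset Strict Implicit.
Unset Printing Implicit Defensive.

Import Order.TTheory GRing.Theory Num.Theory.
Import numFieldNormedType.Exports.
Local Open Scope ring_scope.

(** * Real-rooted polynomials and their low coefficients *)

(** Up to sign, the coefficients are elementary symmetric functions of [s]; the last identity is
    Newton's formula [e_1^2 - 2 e_2 = p_2]. *)
Lemma coef_prod_1subX (C : comNzRingType) (s : seq C) :
  let p := \prod_(a <- s) (1 - a *: 'X) in
  [/\ p`_0 = 1, p`_1 = - \sum_(a <- s) a
    & p`_1 ^+ 2 - p`_2 *+ 2 = \sum_(a <- s) a ^+ 2].
Proof.
elim: s => [|a s [c0 c1 c2]] /=.
  by rewrite !big_nil !coef1 /= expr0n oppr0 mul0rn subr0.
rewrite !big_cons; set p := \prod_(_ <- s) _ in c0 c1 c2 *.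
have coefS k : ((1 - a *: 'X) * p)`_k.+1 = p`_k.+1 - a * p`_k.
  by rewrite mulrBl mul1r -scalerAl coefB coefZ coefXM.
split; last 2 first.
- by rewrite coefS c0 c1 mulr1 opprD addrC.
- rewrite !coefS -c2 c0; ring.
by rewrite mulrBl mul1r -scalerAl coefB coefZ coefXM /= mulr0 subr0.
Qed.

Lemma nonreal_root_of_flat (R : rcfType) (p : {poly R}) :
  p`_0 = 1 -> p`_1 = 0 -> p`_2 = 0 -> p != 1 -> has_nonreal_root p.
Proof.
move=> p0 p1 p2 pn1; apply: contrapT => noroot; case/eqP: pn1.
have rootI z : root (map_poly (real_complex R) p) z -> complex.Im z = 0.
  by move=> rz; apply/eqP; apply: contra_notT noroot => iz; exists z.
set P := map_poly (real_complex R) p in rootI *.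
have [s Ps] := closed_field_poly_normal P.
have cP k : P`_k = real_complex R p`_k by rewrite coef_map.
have P0 : P != 0.
  by apply/eqP => P0; move: (cP 0); rewrite P0 coef0 p0 => /esym/eqP; rewrite oner_eq0.
have sr z : z \in s -> (complex.Im z = 0) /\ z != 0.
  move=> zs; have rz : root P z.
    by rewrite Ps rootZ ?lead_coef_eq0 // root_prod_XsubC.
  split; first exact: rootI.
  apply/eqP => z0; move: rz; rewrite z0 rootE horner_coef0 cP p0.
  by rewrite oner_eq0.
(* Since [P(0) = 1], no root is zero, and the factorization can be normalized at 0 with the inverse
   roots in place of the roots. *)
have PE : P = \prod_(a <- map GRing.inv s) (1 - a *: 'X).
  have -> : \prod_(a <- map GRing.inv s) (1 - a *: 'X) =
      (\prod_(z <- s) (- z^-1)) *: \prod_(z <- s) ('X - z%:P).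
    rewrite -scaler_prod big_map; apply: eq_big_seq => z /sr[_ z0].
    by rewrite scalerBr -!mul_polyC -polyCM mulNr mulVf // polyCN; ring.
  rewrite [LHS]Ps; set Q := \prod_(z <- s) ('X - _).
  congr (_ *: _).
  have Q0 : Q`_0 * \prod_(z <- s) (- z^-1) = 1.
    rewrite -horner_coef0 horner_prod -big_split /= big1_seq // => z /= /sr[_ z0].
    by rewrite !hornerE mulrNN mulfV.
  have LQ : lead_coef P * Q`_0 = 1 by rewrite -coefZ -Ps cP p0.
  by rewrite -[LHS]mulr1 -[X in _ * X = _]Q0 mulrA LQ mul1r.
have [_ _] := coef_prod_1subX (map GRing.inv s).
rewrite -PE !cP p1 p2 rmorph0 expr0n mul0rn subr0 /= => /esym/eqP.
(* The inverse roots are real, so their squares are nonnegative in [R[i]]; a zero sum then forces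
   every inverse root to vanish, hence [s] is empty. *)
rewrite big_map big_seq psumr_eq0 => [|z /sr[iz _]]; last first.
  rewrite real_exprn_even_ge0 // rpredV realE.
  by move: iz; case: z => a b /= ->; rewrite !lecE /= eqxx le_total.
move=> /allP s0.
have sE : s = [::].
  case: s s0 sr {Ps PE} => // z s s0 sr.
  have zs : z \in z :: s by rewrite mem_head.
  have [_ z0] := sr _ zs.
  by move: (s0 _ zs); rewrite zs /= sqrf_eq0 invr_eq0 (negPf z0).
move: PE; rewrite sE big_nil => P1.
apply: (map_poly_inj (real_complex R)).
by rewrite -/P P1 rmorph1.
Qed.

(** * Weights of random subsets *)

(** A general ring allows both [r = rho], which gives [gnp_mass], and the polynomial [r = 1 - 'X],
    which gives the terms of [rel_poly]. *)
Definition bernoulli_mass (A : comNzRingType) (T : finType) (r : A)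
    (D E : {set T}) : A :=
  \prod_(e in D) (if e \in E then r else 1 - r).

(** Conditioning on whether [a] belongs to the random set; this drives the inductions on [D]. *)
Lemma sum_bernoulli_split (A : comNzRingType) (T : finType) (r : A)
    (D : {set T}) (a : T) (g : {set T} -> A) : a \in D ->
  \sum_(E in powerset D) bernoulli_mass r D E * g E =
  r * (\sum_(E in powerset (D :\ a)) bernoulli_mass r (D :\ a) E * g (a |: E))
  + (1 - r) * (\sum_(E in powerset (D :\ a)) bernoulli_mass r (D :\ a) E * g E).
Proof.
move=> aD; rewrite (bigID (fun E : {set T} => a \in E)) /=; congr (_ + _).
- rewrite (reindex_onto (fun E => a |: E) (fun E => E :\ a)) /=; last first.
    by move=> E /andP[_ aE]; rewrite finset.setD1K.
  rewrite mulr_sumr; apply: eq_big => [E|E].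
    rewrite !powersetE finset.subUset finset.sub1set aD finset.setU11 /= andbT subsetD1.
    congr (_ && _); apply/eqP/idP => [<-|aE]; first by rewrite finset.setD11.
    by rewrite finset.setU1K.
  move=> _; rewrite mulrA; congr (_ * _).
  rewrite /bernoulli_mass (big_setD1 a) //= finset.setU11; congr (_ * _).
  by apply: eq_bigr => e; rewrite !inE => /andP[/negPf -> _].
- rewrite mulr_sumr; apply: eq_big => [E|E].
    by rewrite !powersetE subsetD1.
  move=> /andP[_ /negPf aE]; rewrite mulrA; congr (_ * _).
  by rewrite /bernoulli_mass (big_setD1 a) //= aE.
Qed.

Lemma sum_bernoulli_mass (A : comNzRingType) (T : finType) (r : A) (D : {set T}) :
  \sum_(E in powerset D) bernoulli_mass r D E = 1.
Proof.
move: {2}#|D| (erefl #|D|) => m; elim: m D => [|m IH] D cD.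
  have -> : D = finset.set0 by apply/eqP; rewrite -cards_eq0 cD.
  by rewrite powerset0 big_set1 /bernoulli_mass big_set0.
have /card_gt0P[a aD] : (0 < #|D|)%N by rewrite cD.
have := @sum_bernoulli_split A T r D a (fun=> 1) aD.
have mass1 D' : \sum_(E in powerset D') bernoulli_mass r D' E * 1 =
    \sum_(E in powerset D') bernoulli_mass r D' E.
  by apply: eq_bigr => E _; rewrite mulr1.
rewrite !mass1 => ->; rewrite IH; last by move: cD; rewrite (cardsD1 a) aD add1n => -[].
by rewrite !mulr1 addrC subrK.
Qed.

(** Uniqueness of the flattened list makes the pairs disjoint, so the events of containing both
    members of a pair are independent, each of probability [r^2]. *)
Lemma sum_bernoulli_avoid_pairs (A : comNzRingType) (T : finType) (r : A)
    (ps : seq (T * T)) (D : {set T}) :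
  uniq (flatten [seq [:: p.1; p.2] | p <- ps]) ->
  {subset flatten [seq [:: p.1; p.2] | p <- ps] <= D} ->
  \sum_(E in powerset D) bernoulli_mass r D E *
     (all (fun p => ~~ ((p.1 \in E) && (p.2 \in E))) ps)%:R
  = (1 - r ^+ 2) ^+ size ps.
Proof.
elim: ps D => [|[a b] ps IH] D /=.
  move=> _ _; under eq_bigr do rewrite mulr1.
  by rewrite sum_bernoulli_mass expr0.
rewrite !inE negb_or => /andP[/andP[ab aps] /andP[bps ups]] sD.
set L := flatten _ in aps bps sD.
have aD : a \in D by apply: sD; rewrite !inE eqxx.
have bD : b \in D :\ a by rewrite !inE eq_sym ab sD // !inE eqxx orbT.
have irr c (E : {set T}) : c \notin L ->
    all (fun p => ~~ ((p.1 \in c |: E) && (p.2 \in c |: E))) ps =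
    all (fun p => ~~ ((p.1 \in E) && (p.2 \in E))) ps.
  move=> cL; apply: eq_in_all => p pps; rewrite !inE.
  have pL x : x \in [:: p.1; p.2] -> (x == c) = false.
    move=> xp; apply: contraNF cL => /eqP <-; apply/flattenP.
    by exists [:: p.1; p.2] => //; apply/mapP; exists p.
  by rewrite !pL // !inE eqxx ?orbT.
have IHD := IH (D :\ a :\ b) ups.
rewrite (@sum_bernoulli_split _ _ _ _ a) //.
rewrite !(@sum_bernoulli_split _ _ _ (D :\ a) b) //.
set S := (1 - _) ^+ size ps in IHD *.
have {}IHD : \sum_(E in powerset (D :\ a :\ b)) bernoulli_mass r (D :\ a :\ b) E *
     (all (fun p => ~~ ((p.1 \in E) && (p.2 \in E))) ps)%:R = S.
  apply: IHD => e eL; rewrite !inE sD ?inE ?eL ?orbT // andbT.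
  by apply/andP; split; [apply: contraNneq bps|apply: contraNneq aps] => <-.
have nin (E : {set T}) : E \in powerset (D :\ a :\ b) -> (a \in E = false) /\ (b \in E = false).
  rewrite powersetE => /fintype.subsetP sE; split; apply/negP => /sE; rewrite !inE eqxx ?andbF //.
(* The case with both [a] and [b] present vanishes; the other three share the factor [S], with
   weights [r(1-r) + (1-r)r + (1-r)^2 = 1 - r^2]. *)
rewrite [X in r * (r * X + _) + _]big1; last first.
  by move=> E _; rewrite !inE !eqxx !orbT /= mulr0.
rewrite mulr0 add0r.
rewrite [X in r * (_ * X)](eq_bigr (fun E => bernoulli_mass r (D :\ a :\ b) E *
     (all (fun p => ~~ ((p.1 \in E) && (p.2 \in E))) ps)%:R)); last first.
  by move=> E /nin[_ bE]; rewrite irr // !inE bE eq_sym (negPf ab) andbF.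
rewrite [X in _ + _ * (r * X + _)](eq_bigr (fun E => bernoulli_mass r (D :\ a :\ b) E *
     (all (fun p => ~~ ((p.1 \in E) && (p.2 \in E))) ps)%:R)); last first.
  by move=> E /nin[aE _]; rewrite irr // !inE aE (negPf ab).
rewrite [X in _ + _ * (_ + _ * X)](eq_bigr (fun E => bernoulli_mass r (D :\ a :\ b) E *
     (all (fun p => ~~ ((p.1 \in E) && (p.2 \in E))) ps)%:R)); last first.
  by move=> E /nin[-> _].
rewrite !IHD exprS -/S; ring.
Qed.

Lemma bernoulli_massE (A : comNzRingType) (T : finType) (r : A) (D E : {set T}) :
  E \subset D -> bernoulli_mass r D E = r ^+ #|E| * (1 - r) ^+ (#|D| - #|E|).
Proof.
move=> sED; rewrite /bernoulli_mass (big_setID E) /= (finset.setIidPr sED).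
congr (_ * _).
  by rewrite (eq_bigr (fun=> r)) ?prodr_const // => e ->.
rewrite (eq_bigr (fun=> 1 - r)) => [|e]; last by rewrite inE => /andP[/negPf ->].
by rewrite prodr_const cardsD (finset.setIidPr sED).
Qed.

(** * Reliability polynomials and connectivity under few edge deletions *)

(** The terms are Bernoulli weights of parameter [1 - 'X], whose total over all subsets of [E] is
    1. *)
Lemma rel_polyE (R : comNzRingType) (V : finType) (E : {set {set V}}) :
  rel_poly R E =
  1 - \sum_(F in powerset E | ~~ graph_connected F)
        (1 - 'X) ^+ #|F| * 'X ^+ (#|E| - #|F|).
Proof.
apply/eqP; rewrite eq_sym subr_eq; apply/eqP.
rewrite -[LHS](sum_bernoulli_mass (1 - 'X : {poly R}) E).
rewrite (bigID (@graph_connected V)) /=; congr (_ + _); apply: eq_bigr => F.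
all: by rewrite powersetE => /andP[sF _]; rewrite bernoulli_massE // subKr.
Qed.

(** A disconnected [F] omits at least [c] edges, so its term is a multiple of ['X^c]. *)
Lemma coef_rel_poly_small (R : comNzRingType) (V : finType) (E : {set {set V}}) c k :
  (forall F : {set {set V}}, F \subset E -> (#|E| - #|F| < c)%N -> graph_connected F) ->
  (k < c)%N -> (rel_poly R E)`_k = (k == 0)%:R.
Proof.
move=> cE kc; rewrite rel_polyE coefB coef1 coef_sum big1 ?subr0 // => F.
rewrite powersetE => /andP[sF]; apply: contraNeq => nz; apply: cE => //.
apply: leq_ltn_trans kc; rewrite leqNgt; apply: contraNN nz => kE.
by rewrite coefMXn kE.
Qed.

(** At [q = 1] only the empty edge set has nonzero weight, and it cannot join two distinct
    vertices. *)
Lemma rel_poly1 (R : comNzRingType) (V : finType) (E : {set {set V}}) :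
  (1 < #|V|)%N -> (rel_poly R E).[1] = 0.
Proof.
move=> V1; rewrite /rel_poly horner_sum big1 // => F /andP[_ cF].
rewrite hornerM !horner_exp !hornerE subrr expr0n cards_eq0.
case: eqP cF => [->|_ _]; last by rewrite mul0r.
have /card_gt1P[x [y [_ _ xy]]] : (1 < #|predT : {pred V}|)%N by [].
case/andP => _ /'forall_forallP /(_ x y) /connectP[[|z p]] /=.
  by move=> _ yx; rewrite yx eqxx in xy.
by rewrite {1}/edge_rel /= finset.in_set0 andbF.
Qed.

(* Allowing two exceptional vertices [u], [v] makes the negation yield three
   distinct common neighbours of [x] and [y]. *)
Definition no_common_neighbor_off (V : finType) (E : {set {set V}}) (x y u v : V) :=
  [forall z, (z \notin [:: x; y; u; v]) ==>
     ~~ (([set x; z]%SET \in E) && ([set y; z]%SET \in E))].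

Lemma set2_inj_r (V : finType) (x y z w : V) :
  z != x -> z != y -> [set x; z]%SET = [set y; w]%SET -> z = w.
Proof.
move=> zx zy /setP/(_ z); rewrite !inE eqxx orbT (negPf zy) /=.
by move/esym/eqP.
Qed.

(** Three paths [x]-[z]-[y] with distinct midpoints are edge-disjoint, so removing at most two edges
    leaves one of them intact. *)
Lemma connected_of_common_neighbors (V : finType) (E : {set {set V}}) :
  (0 < #|V|)%N ->
  (forall x y u v, x != y -> ~~ no_common_neighbor_off E x y u v) ->
  forall F : {set {set V}}, F \subset E -> (#|E| - #|F| < 3)%N -> graph_connected F.
Proof.
move=> V0 cn F sFE cEF; rewrite /graph_connected V0 /=.
apply/forallP => x; apply/forallP => y.
have [->|xy] := eqVneq x y; first exact: connect0.
apply: contraTT cEF => ncxy; rewrite -leqNgt.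
have nF z : z \notin [:: x; y] ->
    ~~ (([set x; z]%SET \in F) && ([set y; z]%SET \in F)).
  rewrite !inE negb_or => /andP[zx zy]; apply: contraNN ncxy => /andP[xz yz].
  apply: (@connect_trans _ _ z); apply: connect1; rewrite /edge_rel /= ?zy.
    by rewrite eq_sym zx.
  by rewrite finset.setUC.
have step u v : exists z, [/\ z \notin [:: x; y; u; v], [set x; z]%SET \in E
     & [set y; z]%SET \in E].
  have /forallPn[z] := cn x y u v xy.
  by rewrite negb_imply negbK => /andP[h /andP[h1 h2]]; exists z; split.
(* The slots [u], [v] are filled with the neighbours already found; [x x] excludes nothing new at
   the start. *)
have [z1 [n1 a1 b1]] := step x x.
have [z2 [n2 a2 b2]] := step z1 z1.
have [z3 [n3 a3 b3]] := step z1 z2.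
have [z12 z13 z23] : [/\ z1 != z2, z1 != z3 & z2 != z3].
  move: n2 n3; rewrite !inE !negb_or => /and4P[_ _ h _] /and4P[_ _ h' h''].
  by split; rewrite eq_sym.
have {}n1 : z1 \notin [:: x; y].
  by move: n1; rewrite !inE !negb_or => /and4P[-> -> _ _].
have {}n2 : z2 \notin [:: x; y].
  by move: n2; rewrite !inE !negb_or => /and4P[-> -> _ _].
have {}n3 : z3 \notin [:: x; y].
  by move: n3; rewrite !inE !negb_or => /and4P[-> -> _ _].
(* At each common neighbour [z], one of the two edges of the path x-z-y is
   missing from [F]; these missing edges are distinct for distinct [z]. *)
pose g z : {set V} := if [set x; z]%SET \in F then [set y; z]%SET else [set x; z]%SET.
have gE z : z \notin [:: x; y] -> [set x; z]%SET \in E -> [set y; z]%SET \in E ->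
    g z \in E :\: F.
  move=> /nF; rewrite /g; case: ifP => /= [_ yz _ hy|xz _ hx _].
    by rewrite inE yz hy.
  by rewrite inE xz hx.
have ginj z w : z \notin [:: x; y] -> z != w -> g z != g w.
  rewrite !inE negb_or => /andP[zx zy]; apply: contra_neq; rewrite /g.
  by do 2!case: ifP => _; apply: set2_inj_r.
have <- : #|E :\: F| = (#|E| - #|F|)%N by rewrite cardsD (finset.setIidPr sFE).
have /card_uniqP /= <- : uniq [:: g z1; g z2; g z3].
  by rewrite /= !inE negb_or !ginj.
apply: subset_leq_card; apply/fintype.subsetP => e.
by rewrite !inE => /or3P[] /eqP ->; have := gE _ n1 a1 b1;
  have := gE _ n2 a2 b2; have := gE _ n3 a3 b3; rewrite !inE.
Qed.

Lemma nonreal_root_of_common_neighbors (R : rcfType) (V : finType) (E : {set {set V}}) :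
  (1 < #|V|)%N ->
  (forall x y u v, x != y -> ~~ no_common_neighbor_off E x y u v) ->
  graph_connected E /\ has_nonreal_root (rel_poly R E).
Proof.
move=> V1 cn; have cF := connected_of_common_neighbors (ltnW V1) cn.
split; first by apply: cF; rewrite ?subnn.
have cE k := @coef_rel_poly_small R V E 3 k cF.
apply: nonreal_root_of_flat; rewrite ?cE //.
apply/eqP => p1; have := rel_poly1 R E V1; rewrite p1 hornerC => /eqP.
by rewrite oner_eq0.
Qed.

(** * Probability bounds for the random graph *)

(** Distinct [z] involve disjoint edge pairs, so the probability is an exact power of [1 - rho^2].
    Only a bound is stated because [x], [y], [u], [v] may coincide, leaving possibly more than
    [n - 4] choices of [z]. *)
Lemma sum_mass_no_common_neighbor (R : realType) n (rho : R) (x y u v : 'I_n) :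
  0 <= rho -> rho <= 1 -> x != y ->
  \sum_(E in powerset (vpairs 'I_n)) gnp_mass rho E *
    (no_common_neighbor_off E x y u v)%:R <= (1 - rho ^+ 2) ^+ (n - 4).
Proof.
move=> r0 r1 xy.
pose zs := [seq z <- enum 'I_n | z \notin [:: x; y; u; v]].
pose ps := [seq ([set x; z]%SET, [set y; z]%SET) | z <- zs].
have zsP z : z \in zs -> [/\ z != x & z != y].
  by rewrite mem_filter !inE !negb_or => /andP[/and4P[-> -> _ _] _].
have psP e : e \in flatten [seq [:: p.1; p.2] | p <- ps] ->
    exists2 z, z \in zs & (e = [set x; z]%SET \/ e = [set y; z]%SET).
  case/flattenP => L /mapP[p /mapP[z zz ->] ->]; rewrite !inE /=.
  by case/orP => /eqP ->; exists z => //; [left|right].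
have -> : \sum_(E in powerset (vpairs 'I_n)) gnp_mass rho E *
    (no_common_neighbor_off E x y u v)%:R = (1 - rho ^+ 2) ^+ size ps.
  rewrite -(@sum_bernoulli_avoid_pairs R _ rho ps (vpairs 'I_n)).
  - apply: eq_bigr => E _; congr (_ * _%:R); congr nat_of_bool.
    apply/forallP/allP => /= [h p /mapP[z zz ->] /=|h z].
      by move: zz (h z); rewrite mem_filter => /andP[-> _].
    apply/implyP => nz; apply: (h ([set x; z]%SET, [set y; z]%SET)).
    by apply: map_f; rewrite mem_filter nz mem_enum.
  - have : uniq zs by rewrite filter_uniq ?enum_uniq.
    rewrite /ps {psP ps}; elim: zs zsP => //= z zs' IH zsP /andP[zzs uzs].
    have [zx zy] := zsP z (mem_head _ _).
    have /= -> := IH (fun w wzs => zsP w (@mem_behead _ (z :: zs') w wzs)) uzs.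
    (* As [z] is neither [x] nor [y], an edge joining it to one of them determines [z]; hence no
       edge recurs for another midpoint. *)
    have nin c : c \notin [:: z] -> c \in [:: x; y] ->
        [set c; z]%SET \notin flatten [seq [:: p.1; p.2] | p <-
          [seq ([set x; w]%SET, [set y; w]%SET) | w <- zs']].
      rewrite !inE => cz cxy.
      apply/negP => /flattenP[L /mapP[p /mapP[w ww ->] ->]]; rewrite !inE /=.
      have zw : z != w by apply: contraNneq zzs => ->.
      have zc : z != c by rewrite eq_sym.
      by case/orP => /eqP /set2_inj_r => /(_ zc) h; move: zw; rewrite h ?eqxx.
    rewrite !inE negb_or !nin ?inE ?eqxx ?orbT ?(eq_sym x z) ?(eq_sym y z) //=.
    rewrite !andbT; apply: contra xy => /eqP/setP/(_ x).
    by rewrite !inE eqxx /= (eq_sym x z) (negPf zx) orbF => /esym.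
  move=> e /psP[z /zsP[zx zy] [->|->]]; rewrite inE cards2 (eq_sym _ z).
    by rewrite zx.
  by rewrite zy.
have le1 : 0 <= 1 - rho ^+ 2 <= 1.
  by rewrite subr_ge0 exprn_ile1 // gerBl exprn_ge0.
case/andP: le1 => le0 le1; apply: ler_wiXn2l => //.
rewrite size_map size_filter -[count _ _]/(count (predC (mem [:: x; y; u; v])) _).
have := count_predC (mem [:: x; y; u; v]) (enum 'I_n).
rewrite size_enum_ord.
have : (count (mem [:: x; y; u; v]) (enum 'I_n) <= 4)%N.
  rewrite -size_filter; apply: (@uniq_leq_size _ _ [:: x; y; u; v]).
    by rewrite filter_uniq ?enum_uniq.
  by move=> z; rewrite mem_filter => /andP[].
lia.
Qed.

Lemma gnp_prob_le1 (R : realType) n (rho : R) (A : {set {set 'I_n}} -> Prop) :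
  0 <= rho -> rho <= 1 -> gnp_prob rho A <= 1.
Proof.
move=> r0 r1; rewrite -(sum_bernoulli_mass rho (vpairs 'I_n)) /gnp_prob.
rewrite [leRHS](bigID (fun E => `[< A E >])) /= lerDl sumr_ge0 // => E _.
by rewrite prodr_ge0 // => e _; case: ifP; rewrite ?subr_ge0.
Qed.

Lemma gnp_prob_ge (R : realType) n (rho : R) : (1 < n)%N -> 0 <= rho -> rho <= 1 ->
  1 - n%:R ^+ 4 * (1 - rho ^+ 2) ^+ (n - 4) <=
  gnp_prob rho (fun G : {set {set 'I_n}} =>
    graph_connected G /\ has_nonreal_root (rel_poly R G)).
Proof.
move=> n1 r0 r1; set A := fun G => _.
have m0 (E : {set {set 'I_n}}) : 0 <= gnp_mass rho E.
  by rewrite prodr_ge0 // => e _; case: ifP; rewrite ?subr_ge0.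
(* With 1 written as the total mass, the part on [A] cancels and the mass of the complement remains
   to be bounded. *)
rewrite lerBlDr -{1}(sum_bernoulli_mass rho (vpairs 'I_n)).
rewrite [leLHS](bigID (fun E => `[< A E >])) /= lerD2l.
pose bad (E : {set {set 'I_n}}) (q : 'I_n * 'I_n * 'I_n * 'I_n) :=
  (q.1.1.1 != q.1.1.2) && no_common_neighbor_off E q.1.1.1 q.1.1.2 q.1.2 q.2.
(* Union bound: a graph outside [A] has at least one bad quadruple, so its mass is counted at least
   once. *)
apply: (@le_trans _ _ (\sum_(E in powerset (vpairs 'I_n))
    \sum_(q : 'I_n * 'I_n * 'I_n * 'I_n) gnp_mass rho E * (bad E q)%:R)).
  rewrite big_mkcondr /=; apply: ler_sum => E _; case: ifPn => [nA|_]; last first.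
    by apply: sumr_ge0 => q _; rewrite mulr_ge0 ?m0 ?ler0n.
  have [q bq] : exists q, bad E q.
    apply: contrapT => nex; move/asboolP: nA; apply.
    apply: nonreal_root_of_common_neighbors; first by rewrite card_ord.
    move=> x y u v xy; apply/negP => h; apply: nex.
    by exists (x, y, u, v); rewrite /bad /= xy.
  rewrite (bigD1 q) //= bq mulr1 lerDl; apply: sumr_ge0 => q' _.
  by rewrite mulr_ge0 ?m0 ?ler0n.
rewrite exchange_big /=.
apply: (@le_trans _ _ (\sum_(q : 'I_n * 'I_n * 'I_n * 'I_n) (1 - rho ^+ 2) ^+ (n - 4))).
  apply: ler_sum => -[[[x y] u] v] _; rewrite /bad /=.
  have [xy|xy] := eqVneq x y.
    rewrite big1 => [|E _]; last by rewrite mulr0.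
    by rewrite exprn_ge0 // subr_ge0 exprn_ile1.
  exact: sum_mass_no_common_neighbor.
rewrite sumr_const -[leLHS]mulr_natl !card_prod card_ord !natrM.
by have -> : n%:R ^+ 4 = n%:R * n%:R * n%:R * n%:R :> R by ring.
Qed.

(** * Asymptotics of the error term *)

Lemma cvg_natX4_geometric (R : realType) (r : R) : 0 < r -> r < 1 ->
  ((fun n : nat => n%:R ^+ 4 * r ^+ n) @ \oo --> (0 : R))%classic.
Proof.
move=> r0 r1.
(* With [r = s^8], [n^4 r^n = (n s^n)^4 (s^4)^n], and [n s^n] is bounded by
   Bernoulli's inequality. *)
pose s := Num.sqrt (Num.sqrt (Num.sqrt r)).
have s0 : 0 < s by rewrite !sqrtr_gt0.
have s8 : s ^+ 8 = r.
  by rewrite -[8%N]/(2 * (2 * 2))%N !exprM !sqr_sqrtr ?sqrtr_ge0 // ltW.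
have s1 : s < 1.
  by rewrite -(@ltr_pXn2r _ 8) ?nnegrE ?ler01 ?(ltW s0) // s8 expr1n.
(* With [1 + t = s^-1], the inequality [1 + n t <= (1 + t)^n] yields [n s^n <= t^-1]. *)
pose t := s^-1 - 1.
have t0 : 0 < t by rewrite subr_gt0 invf_gt1.
have nt n : n%:R * s ^+ n <= t^-1.
  have : 1 + n%:R * t <= (1 + t) ^+ n.
    elim: n => [|n IH]; first by rewrite mul0r addr0 expr0.
    rewrite exprS; apply: (le_trans _ (ler_wpM2l _ IH)); last by rewrite addr_ge0 ?ler01 // ltW.
    rewrite -natr1; have : 0 <= n%:R * (t * t) by rewrite mulr_ge0 ?mulr_ge0 // ltW.
    by move: (n%:R : R) => m; nra.
  rewrite /t addrCA subrr addr0 exprVn => h.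
  rewrite -ler_pdivlMr ?exprn_gt0 // ler_pdivlMl // mulrC.
  by apply: le_trans h; rewrite lerDr.
apply: (@squeeze_cvgr _ _ _ _ (fun=> 0) (geometric (t^-1 ^+ 4) (s ^+ 4))).
- near=> n; rewrite mulr_ge0 ?exprn_ge0 ?(ltW r0) //=.
  have -> : n%:R ^+ 4 * r ^+ n = (n%:R * s ^+ n) ^+ 4 * (s ^+ 4) ^+ n.
    rewrite -s8 [(n%:R * _) ^+ 4]exprMn -[RHS]mulrA; congr (_ * _).
    by rewrite -[s ^+ 8 ^+ n]exprM -[s ^+ n ^+ 4]exprM -[s ^+ 4 ^+ n]exprM -exprD; congr (s ^+ _); lia.
  rewrite ler_wpM2r ?exprn_ge0 ?(ltW s0) // lerXn2r ?nnegrE ?invr_ge0 ?(ltW t0) //.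
  by rewrite mulr_ge0 ?exprn_ge0 ?(ltW s0).
- exact: cvg_cst.
- by apply: cvg_geometric; rewrite ger0_norm ?exprn_ge0 ?exprn_ilt1 // ltW.
Unshelve. all: by end_near. Qed.

Local Open Scope classical_set_scope.
Local Open Scope ring_scope.

Theorem theorem2p2 (R : realType) (rho : R) (rho_gt0 : 0 < rho) (rho_lt1 : rho < 1) :
  (fun n : nat => gnp_prob rho (fun G : {set {set 'I_n}} =>
      graph_connected G /\ has_nonreal_root (rel_poly R G)))
    @ \oo --> (1 : R).
Proof.
have r0 := ltW rho_gt0; have r1 := ltW rho_lt1.
set r := 1 - rho ^+ 2.
have rp : 0 < r by rewrite subr_gt0 exprn_ilt1.
have rl : r < 1 by rewrite gtrBl exprn_gt0.
(* The factor [r^-4] undoes the shift in [r^(n - 4)]; since natural subtraction truncates, this is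
   valid only for [n >= 4]. *)
apply: (@squeeze_cvgr _ _ _ _ (fun n => 1 - n%:R ^+ 4 * r ^+ n * r ^- 4) (fun=> 1)).
- near=> n; rewrite gnp_prob_le1 // andbT.
  have n4 : (4 <= n)%N by near: n; exact: nbhs_infty_ge.
  have -> : n%:R ^+ 4 * r ^+ n * r ^- 4 = n%:R ^+ 4 * r ^+ (n - 4).
    rewrite -mulrA -[X in _ * (r ^+ X * _) = _](subnK n4) exprD -[X in _ * X]mulrA mulfV ?mulr1 //.
    by rewrite expf_neq0 // gt_eqF.
  by apply: gnp_prob_ge => //; apply: leq_trans n4.
- rewrite -[X in _ --> X]subr0 -[X in _ --> _ - X](mul0r (r ^- 4)).
  apply: cvgB; first exact: cvg_cst.
  by apply: cvgMl; apply: cvg_natX4_geometric.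
- exact: cvg_cst.
Unshelve. all: by end_near. Qed.
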